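(* Let $\mathcal{H}$ be a real Hilbert space, let $\beta\in\,]0,+\infty[$, let $A\colon\mathcal{H}\to 2^{\mathcal{H}}$ be maximally monotone, let $B\colon\mathcal{H}\to\mathcal{H}$ be monotone and $\beta$-Lipschitzian, and suppose that $Z=\mathrm{zer}(A+B)\neq\varnothing$. Let $x_0\in\mathcal{H}$, let $\varepsilon\in\,]0,1/(\beta+1)[$, and let $(\gamma_n)_{n\in\mathbb{N}}$ be a sequence in $[\varepsilon,(1-\varepsilon)/\beta]$. Iterate, for every $n\in\mathbb{N}$, $$b_n^*=\gamma_nBx_n,\quad m_n=J_{\gamma_nA}(x_n-b_n^* ),\quad r_n=\frac12\bigl(x_n+m_n-\gamma_nBm_n+b_n^*\bigr),\quad x_{n+1}=\mathsf{Q}(x_0,x_n,r_n).$$ Then $(x_n)_{n\in\mathbb{N}}$ converges strongly to $\mathrm{proj}_Zx_0$.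
   Context: For $M\colon\mathcal{H}\to2^{\mathcal{H}}$, $\mathrm{zer}\,M=\{x\mid 0\in Mx\}$ and $J_M=(\mathrm{Id}+M)^{-1}$ is the resolvent (single-valued and defined everywhere when $M$ is maximally monotone). $M$ is maximally monotone if it is monotone and no monotone operator has a graph strictly containing that of $M$. $\mathrm{proj}_D$ is the projection operator onto a nonempty closed convex set $D$. For $(x,y)\in\mathcal{H}^2$, $H(x,y)=\{z\in\mathcal{H}\mid\langle z-y\mid x-y\rangle\leq 0\}$; for $(x,y,z)\in\mathcal{H}^3$ such that $H(x,y)\cap H(y,z)\neq\varnothing$, $\mathsf{Q}(x,y,z)$ is the projection of $x$ onto $H(x,y)\cap H(y,z)$. *)

(* Defs.v *)
From HB Require Import structures.
From mathcomp Require Import all_boot all_order all_algebra.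
From mathcomp Require Import all_classical all_reals all_analysis.
Set Implicit Arguments.
Unset Strict Implicit.
Unset Printing Implicit Defensive.
Import Order.TTheory GRing.Theory Num.Theory.
Import numFieldNormedType.Exports.
Local Open Scope classical_set_scope.
Local Open Scope ring_scope.

(* A real Hilbert space is a complete normed space [H] together with a
   positive definite symmetric bilinear form [ip : {dot H for idfun}] that
   induces the norm of [H]. *)
Definition induces_norm (R : realType) (H : completeNormedModType R)
    (ip : {dot H for idfun}) : Prop :=
  forall x : H, `|x| = Num.sqrt (ip x x).

(* A set-valued operator from H to 2^H is a function [H -> set H]. *)
Definition op_graph (H : Type) (M : H -> set H) : set (H * H) :=
  [set p | M p.1 p.2].

Definition op_fun (H : Type) (B : H -> H) : H -> set H := fun x => [set B x].

Definition op_add (H : zmodType) (M N : H -> set H) : H -> set H :=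
  fun x => [set u + v | u in M x & v in N x].

Definition op_scale (R : realType) (H : lmodType R) (c : R) (M : H -> set H) :
    H -> set H :=
  fun x => [set c *: u | u in M x].

Definition op_inv (H : Type) (M : H -> set H) : H -> set H :=
  fun u => [set x | M x u].

Definition zer (H : zmodType) (M : H -> set H) : set H := [set x | M x 0].

Definition monotone_op (R : realType) (H : completeNormedModType R)
    (ip : {dot H for idfun}) (M : H -> set H) : Prop :=
  forall x y u v : H, M x u -> M y v -> 0 <= ip (x - y) (u - v).

Definition maximally_monotone_op (R : realType) (H : completeNormedModType R)
    (ip : {dot H for idfun}) (M : H -> set H) : Prop :=
  monotone_op ip M /\
  forall N : H -> set H, monotone_op ip N -> ~ (op_graph M `<` op_graph N).

(* [get] returns an unspecified point when there is none satisfying the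
   predicate; [resolvent M] is meaningful when (Id + M)^-1 is single-valued
   and everywhere defined, e.g. when M is maximally monotone. *)
Definition resolvent (R : realType) (H : completeNormedModType R)
    (M : H -> set H) : H -> H :=
  fun x => get (op_inv (op_add (op_fun id) M) x).

(* Meaningful when [D] is nonempty, closed and convex. *)
Definition metric_proj (R : realType) (H : completeNormedModType R)
    (D : set H) (x : H) : H :=
  get [set p | D p /\ forall q, D q -> `|x - p| <= `|x - q|].

Definition halfspace (R : realType) (H : completeNormedModType R)
    (ip : {dot H for idfun}) (x y : H) : set H :=
  [set z | ip (z - y) (x - y) <= 0].

(* Meaningful when the intersection is nonempty. *)
Definition Qproj (R : realType) (H : completeNormedModType R)
    (ip : {dot H for idfun}) (x y z : H) : H :=
  metric_proj (halfspace ip x y `&` halfspace ip y z) x.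

(* Main.v *)
(* Zeros of A + B lie in every half-space H(x_n, r_n), by the estimate for
   Tseng's step, and then in every H(x_0, x_n), by induction. Hence |x_0 - x_n|
   increases to some l <= |x_0 - z| for every zero z, the increments of x_n tend
   to 0, and so do x_n - m_n and some w_n in (A + B) m_n. Weak compactness is
   replaced by an elementary argument: there is p with |x_0 - p| <= l satisfying
   every affine inequality that x_n satisfies eventually. Passing to the limit in
   <m_n - u, w_n - v> >= 0 shows that p is a zero, so that l is the distance from
   x_0 to the zeros, and |q - x_n|^2 <= |x_0 - q|^2 - |x_0 - x_n|^2 for the
   projection q of x_0 gives strong convergence. That the resolvents are defined
   everywhere is Minty's theorem, obtained by maximizing a strongly concave
   function over the convex hull of the graph. *)
Require Import Defs.
From HB Require Import structures.
From mathcomp Require Import all_boot all_order all_algebra.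
From mathcomp Require Import all_classical all_reals all_analysis.
From mathcomp Require Import ring lra.
Set Implicit Arguments.
Unset Strict Implicit.
Unset Printing Implicit Defensive.
Import Order.TTheory GRing.Theory Num.Theory.
Import numFieldNormedType.Exports.
Local Open Scope classical_set_scope.
Local Open Scope ring_scope.

(** * Inner products, Cauchy-Schwarz and a Cauchy criterion *)

Section Hilbert.
Variables (R : realType) (H : completeNormedModType R) (ip : {dot H for idfun}).

Lemma ipC x y : ip x y = ip y x.
Proof. by rewrite hermC expr0 mul1r. Qed.

Lemma ipDl x y z : ip (x + y) z = ip x z + ip y z.
Proof. by rewrite linearDl. Qed.

Lemma ipBl x y z : ip (x - y) z = ip x z - ip y z.
Proof. by rewrite linearBl. Qed.

Lemma ipNl x y : ip (- x) y = - ip x y.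
Proof. by rewrite linearNl. Qed.

Lemma ipZl a x y : ip (a *: x) y = a * ip x y.
Proof. by rewrite linearZl_LR. Qed.

Lemma ipDr x y z : ip x (y + z) = ip x y + ip x z.
Proof. by rewrite !(ipC x) ipDl. Qed.

Lemma ipBr x y z : ip x (y - z) = ip x y - ip x z.
Proof. by rewrite !(ipC x) ipBl. Qed.

Lemma ipNr x y : ip x (- y) = - ip x y.
Proof. by rewrite !(ipC x) ipNl. Qed.

Lemma ipZr a x y : ip x (a *: y) = a * ip x y.
Proof. by rewrite !(ipC x) ipZl. Qed.

Lemma ip0r x : ip x 0 = 0.
Proof. by rewrite -(scale0r 0) ipZr mul0r. Qed.

Definition ipE := (ipDl, ipBl, ipNl, ipZl, ipDr, ipBr, ipNr, ipZr).

Lemma ip_ge0 x : 0 <= ip x x.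
Proof.
by have [->|/neq0_dnorm_gt0/ltW] := eqVneq x 0; first by rewrite ip0r.
Qed.

Hypothesis ip_norm : induces_norm ip.

Lemma ip_normE x : ip x x = `|x| ^+ 2.
Proof. by rewrite ip_norm sqr_sqrtr ?ip_ge0. Qed.

Lemma ip_le_norm x y : ip x y <= `|x| * `|y|.
Proof.
have [->|y0] := eqVneq y 0; first by rewrite ip0r normr0 mulr0.
have ny0 : 0 < `|y| by rewrite normr_gt0.
(* This square expands to [2 |x| |y| (|x| |y| - ip x y)]. *)
have := ip_ge0 (`|y| *: x - (`|x|) *: y).
rewrite !ipE !ip_normE (ipC y x) => h.
have [->|x0] := eqVneq x 0; first by rewrite ipC ip0r normr0 mul0r.
have nx0 : 0 < `|x| by rewrite normr_gt0.
rewrite -subr_ge0 -(pmulr_rge0 _ (mulr_gt0 nx0 ny0)).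
by rewrite -(pmulr_rge0 _ (ltr0n R 2)); apply: le_trans h _; lra.
Qed.

Lemma ler_norm_ip x y : `|ip x y| <= `|x| * `|y|.
Proof.
by rewrite ler_norml ip_le_norm andbT lerNl -ipNl -(normrN x) ip_le_norm.
Qed.

Lemma cvg_ipl (T : Type) (F : set_system T) (FF : Filter F)
    (f : T -> H) l a : f @ F --> l -> ip (f t) a @[t --> F] --> ip l a.
Proof.
move=> fl; apply/cvgrPdist_le => e e0.
have d0 : 0 < e / (`|a| + 1) by rewrite divr_gt0// ltr_wpDl.
move/cvgrPdist_le : fl => /(_ _ d0) fl; near=> t.
rewrite -ipBl; apply: le_trans (ler_norm_ip _ _) _.
have : `|l - f t| <= e / (`|a| + 1) by near: t.
rewrite ler_pdivlMr ?ltr_wpDl// => ?.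
by apply: le_trans (ler_wpM2l _ _) _; [..|eassumption]; rewrite // lerDl.
Unshelve. all: by end_near. Qed.

Lemma closed_ip_le a c : closed [set p : H | ip p a <= c].
Proof.
apply: (closed_comp (f := fun p => ip p a)) (@closed_le R c) => p _.
exact: cvg_ipl.
Qed.

(** Stated for squared distances to later terms, which is what midpoint and Pythagoras estimates
    provide. *)
Lemma cvg_sqr_dist (u : nat -> H) (e : nat -> R) :
  e @ \oo --> 0 -> (forall n k, (n <= k)%N -> `|u n - u k| ^+ 2 <= e n) ->
  exists l : H, u @ \oo --> l.
Proof.
move=> e0 ue; suff : cvg (u @ \oo) by move=> ul; exists (lim (u @ \oo)).
apply/cauchy_cvgP/cauchy_exP => d d0.
move/cvgr_lt : e0 => /(_ _ (exprn_gt0 2 d0))[N _ eN].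
exists (u N), N => // k /= Nk; rewrite -ball_normE /=.
rewrite -ltr_sqr ?nnegrE ?(ltW d0)//.
by apply: le_lt_trans (ue _ _ Nk) _; apply: eN => /=.
Qed.

End Hilbert.

(** * Projections onto closed convex sets *)

Section ConvexSets.
Variables (R : realType) (H : completeNormedModType R) (ip : {dot H for idfun}).
Hypothesis ip_norm : induces_norm ip.

Lemma convex_set_segment (C : set H) p q t :
  convex_set (C : set (convex_lmodType H)) -> C p -> C q -> 0 <= t <= 1 ->
  C (p + t *: (q - p)).
Proof.
move=> cC Cp Cq /andP[t0 t1].
have := cC q p (Itv01 t0 t1); rewrite !inE => /(_ Cq Cp).
rewrite /conv/= /unstable.onem scalerBl scale1r.
by congr (C _); rewrite scalerBr addrCA addrA.
Qed.

Lemma convex_ip_le a c :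
  convex_set ([set p | ip p a <= c] : set (convex_lmodType H)).
Proof.
move=> p q t; rewrite !inE /= => pc qc; rewrite /conv/= /unstable.onem ipDl !ipZl.
have t0 : 0 <= t%:num by [].
have t1 : 0 <= 1 - t%:num by rewrite subr_ge0 le1.
have := lerD (ler_wpM2l t0 pc) (ler_wpM2l t1 qc).
by move=> /le_trans; apply; rewrite -mulrDl addrC subrK mul1r.
Qed.

Lemma convex_bigcap (M : lmodType R) I (D : set I)
    (F : I -> set (convex_lmodType M)) :
  (forall i, D i -> convex_set (F i)) -> convex_set (\bigcap_(i in D) F i).
Proof.
move=> cF p q t; rewrite !inE => Fp Fq i Di.
by have := cF i Di p q t; rewrite !inE; apply; [exact: Fp|exact: Fq].
Qed.

Lemma convex_setI (M : lmodType R) (C D : set (convex_lmodType M)) :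
  convex_set C -> convex_set D -> convex_set (C `&` D).
Proof.
move=> cC cD p q t; rewrite !inE => -[Cp Dp] [Cq Dq]; split.
  by have := cC p q t; rewrite !inE; exact.
by have := cD p q t; rewrite !inE; exact.
Qed.

Lemma halfspaceE x y :
  halfspace ip x y = [set z | ip z (x - y) <= ip y (x - y)].
Proof. by apply/seteqP; split => z; rewrite /halfspace/= ipBl subr_le0. Qed.

Lemma cvg_sqr_norm (f : nat -> H) l :
  f @ \oo --> l -> (fun n => `|f n| ^+ 2) @ \oo --> `|l| ^+ 2.
Proof.
move=> /cvg_norm fl; rewrite expr2 (_ : (fun _ => _) = fun n => `|f n| * `|f n|).
  exact: cvgM.
by apply/funext => n; rewrite expr2.
Qed.

(** Discards the second-order remainder in first-order optimality conditions, with [t] running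
    through [1 / (n + 1)]. *)
Lemma ler_small (a b : R) : (forall t, 0 < t <= 1 -> a <= t * b) -> a <= 0.
Proof.
move=> ab; have h0 : (fun n => harmonic n * b) @ \oo --> 0 * b.
  by apply: cvgMr_tmp; exact: cvg_harmonic.
rewrite mul0r in h0; apply: cvgr_to_ge h0 _; apply: nearW => n.
by apply: ab; rewrite harmonic_gt0/= invf_le1 ?ler1n.
Qed.

Lemma nearest_exists (C : set H) x :
  C !=set0 -> closed C -> convex_set (C : set (convex_lmodType H)) ->
  exists2 p, C p & forall q, C q -> `|x - p| <= `|x - q|.
Proof.
move=> [c0 Cc0] clC cC.
pose E := [set `|x - q| ^+ 2 | q in C].
have lbE : lbound E 0 by move=> _ [q _ <-]; rewrite exprn_ge0.
have infE : has_inf E by split; [exists (`|x - c0| ^+ 2), c0|exists 0].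
have ex n : exists u, C u /\ `|x - u| ^+ 2 < inf E + @harmonic R n.
  have [_ [q Cq <-] ?] := inf_adherent (@harmonic_gt0 R n) infE.
  by exists q.
have [u /all_and2[Cu xu]] := choice ex.
have e0 : (fun n => 4 * @harmonic R n) @ \oo --> 0.
  by rewrite -[X in _ --> X](mulr0 4); apply: cvgMl_tmp; exact: cvg_harmonic.
have [|p up] := cvg_sqr_dist e0 (u := u).
  move=> n k nk.
  (* The midpoint is no closer to [x] than the infimum, so the parallelogram law gives [|u n - u
     k|^2 <= 2 / (n + 1) + 2 / (k + 1)]. *)
  have mid : C (u n + 2^-1 *: (u k - u n)).
    by apply: convex_set_segment => //; lra.
  have : inf E <= `|x - (u n + 2^-1 *: (u k - u n))| ^+ 2.
    by apply: ge_inf; [exists 0|eexists; [exact: mid|]].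
  have hk : @harmonic R k <= harmonic n by rewrite /= lef_pV2 ?posrE// ler_nat.
  move: (xu n) (xu k); rewrite -!(ip_normE ip_norm) !ipE.
  rewrite !(ipC _ x) (ipC _ (u k) (u n)); lra.
have Cp : C p by apply: closed_cvg up => //; exact: nearW.
exists p => // q Cq; rewrite -ler_sqr ?nnegrE//.
apply: (@le_trans _ _ (inf E)); last by apply: ge_inf; [exists 0|exists q].
rewrite -[leRHS]addr0.
have xup : (fun n => `|x - u n| ^+ 2) @ \oo --> `|x - p| ^+ 2.
  by apply: cvg_sqr_norm; apply: cvgB => //; exact: cvg_cst.
apply: (ler_cvg_to xup (cvgD (cvg_cst (inf E)) cvg_harmonic)).
by apply: nearW => n; apply/ltW/xu.
Qed.

(** Moving from [p] a fraction [t] of the way to [q] does not shorten the distance to [x]; divide by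
    [t] and let [t] tend to 0. *)
Lemma nearest_ip_le0 (C : set H) x p q :
  convex_set (C : set (convex_lmodType H)) -> C p ->
  (forall q, C q -> `|x - p| <= `|x - q|) -> C q -> ip (q - p) (x - p) <= 0.
Proof.
move=> cC Cp xp Cq; rewrite -(pmulr_rle0 _ (ltr0n R 2)).
apply: (@ler_small _ (`|q - p| ^+ 2)) => t /andP[t0 t1].
have : `|x - p| <= `|x - (p + t *: (q - p))|.
  by apply: xp; apply: convex_set_segment; rewrite ?(ltW t0).
rewrite -ler_sqr ?nnegrE// -!(ip_normE ip_norm) opprD addrA => h.
rewrite -(ler_pM2l t0); move: h.
move: (x - p) (q - p) => y z; rewrite !ipE (ipC _ y z); lra.
Qed.

Lemma closed_halfspace x y : closed (halfspace ip x y).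
Proof. by rewrite halfspaceE; exact: closed_ip_le. Qed.

Lemma convex_halfspace x y :
  convex_set (halfspace ip x y : set (convex_lmodType H)).
Proof. by rewrite halfspaceE; exact: convex_ip_le. Qed.

Lemma metric_projP (D : set H) x p :
  D p -> (forall q, D q -> `|x - p| <= `|x - q|) ->
  D (metric_proj D x) /\ forall q, D q -> `|x - metric_proj D x| <= `|x - q|.
Proof.
move=> Dp xp; pose nearest p := D p /\ forall q, D q -> `|x - p| <= `|x - q|.
by apply: (@getPex _ nearest); exists p.
Qed.

(** The second part, the obtuse-angle property of the projection, drives the induction that keeps
    the zeros in every half-space. *)
Lemma QprojP x y z :
  halfspace ip x y `&` halfspace ip y z !=set0 ->
  (halfspace ip x y `&` halfspace ip y z) (Qproj ip x y z) /\
  (forall q, (halfspace ip x y `&` halfspace ip y z) q ->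
    halfspace ip x (Qproj ip x y z) q).
Proof.
move=> Q0.
have cvxQ : convex_set
    (halfspace ip x y `&` halfspace ip y z : set (convex_lmodType H)).
  by apply: convex_setI; exact: convex_halfspace.
have [|p Qp xp] := nearest_exists x Q0 _ cvxQ.
  by apply: closedI; exact: closed_halfspace.
have [Qq xq] := metric_projP Qp xp; split=> // q Qz.
exact: nearest_ip_le0 cvxQ Qq xq Qz.
Qed.

End ConvexSets.

(** * Minty's theorem and resolvents *)

Section Minty.
Variables (R : realType) (H : completeNormedModType R) (ip : {dot H for idfun}).
Hypothesis ip_norm : induces_norm ip.

(** The convex hull of the points [(a, b, ip a b)], generated by segments so that affine
    inequalities follow by induction. *)
Inductive graph_hull (G : H -> H -> Prop) : H -> H -> R -> Prop :=
| GraphHullPoint a b of G a b : graph_hull G a b (ip a b)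
| GraphHullSegment t a b d a' b' d' of 0 <= t <= 1 &
    graph_hull G a b d & graph_hull G a' b' d' :
    graph_hull G (a + t *: (a' - a)) (b + t *: (b' - b)) (d + t * (d' - d)).

(* Both sides are affine in each of the two triples, so the inequality need
   only be checked on the graph, where it says that [G] is antitone. *)
Lemma graph_hull_antitone (G : H -> H -> Prop) a b d a' b' d' :
  (forall a b a' b', G a b -> G a' b' -> ip (a - a') (b - b') <= 0) ->
  graph_hull G a b d -> graph_hull G a' b' d' ->
  d + d' <= ip a b' + ip a' b.
Proof.
move=> antiG hd; elim=> {a' b' d'} [a' b' Gab'|].
  elim: hd => {a b d} [a b Gab|].
    by have := antiG _ _ _ _ Gab Gab'; rewrite !ipE; lra.
  move=> t a b d a1 b1 d1 /andP[t0 t1] _ le0 _ le1; rewrite !ipE.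
  have t1' : 0 <= 1 - t by lra.
  by have := lerD (ler_wpM2l t1' le0) (ler_wpM2l t0 le1); lra.
move=> t a0 b0 d0 a1 b1 d1 /andP[t0 t1] _ le0 _ le1; rewrite !ipE.
have t1' : 0 <= 1 - t by lra.
by have := lerD (ler_wpM2l t1' le0) (ler_wpM2l t0 le1); lra.
Qed.

(* The point is the limit of [(a + b) / 2] along a maximizing sequence of the
   strongly concave function [d - |(a + b) / 2|^2], which is nonpositive on the
   convex hull; the conclusion is the first-order optimality condition. *)
Lemma antitone_saddle (G : H -> H -> Prop) :
  (forall a b a' b', G a b -> G a' b' -> ip (a - a') (b - b') <= 0) ->
  exists c, forall a b, G a b -> ip (c - a) (c - b) <= 0.
Proof.
move=> antiG.
have [[a0 [b0 G0]]|G0] := pselect (exists a b, G a b); last first.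
  by exists 0 => a b Gab; case: G0; exists a, b.
pose mid (p : H * H * R) := 2^-1 *: (p.1.1 + p.1.2).
pose g p := p.2 - ip (mid p) (mid p).
pose K : set (H * H * R) := [set p | graph_hull G p.1.1 p.1.2 p.2].
have g_le0 p : K p -> g p <= 0.
  (* Pairing a triple with itself gives [d <= ip a b], and [ip a b <= |(a + b) / 2|^2]. *)
  move=> Kp; have := graph_hull_antitone antiG Kp Kp.
  have := ip_ge0 ip (p.1.1 - p.1.2).
  by rewrite /g /mid !ipE (ipC _ p.1.2 p.1.1); lra.
have K0 : K (a0, b0, ip a0 b0) by exact: GraphHullPoint.
have supE : has_sup (g @` K).
  by split; [exists (g (a0, b0, ip a0 b0)), (a0, b0, ip a0 b0)|
             exists 0 => _ [p Kp <-]; exact: g_le0].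
set s := sup (g @` K) in supE.
have s_le0 : s <= 0.
  by apply: ge_sup => [|_ [p Kp <-]]; [case: supE|exact: g_le0].
have g_le p : K p -> g p <= s.
  by move=> Kp; apply: ub_le_sup; [case: supE|exists p].
have ex n : exists p, K p /\ s - @harmonic R n < g p.
  have [_ [p Kp <-] ?] := sup_adherent (@harmonic_gt0 R n) supE.
  by exists p.
have [p /all_and2[Kp gp]] := choice ex.
(* Strong concavity: on a segment, [g] exceeds its affine interpolation by
   [t (1 - t) |mid i - mid j|^2]. *)
have seg (t : R) i j : 0 <= t <= 1 -> K i -> K j ->
    g i + t * (g j - g i) + t * (1 - t) * ip (mid i - mid j) (mid i - mid j) <= s.
  move=> t01 Ki Kj.
  have := g_le (i.1.1 + t *: (j.1.1 - i.1.1), i.1.2 + t *: (j.1.2 - i.1.2),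
                i.2 + t * (j.2 - i.2)) (GraphHullSegment t01 Ki Kj).
  rewrite {1}/g (_ : mid (_, _) = mid i + t *: (mid j - mid i)) /=; last first.
    rewrite /mid /= -scalerBr scalerA (mulrC t) -scalerA -scalerDr addrACA.
    by rewrite -scalerDr opprD (addrACA j.1.1).
  rewrite /g; move: (mid i) (mid j) => mi mj.
  by rewrite !ipE (ipC _ mj mi); lra.
have e0 : (fun n => 4 * @harmonic R n) @ \oo --> 0.
  by rewrite -[X in _ --> X](mulr0 4); apply: cvgMl_tmp; exact: cvg_harmonic.
have [|c pc] := cvg_sqr_dist e0 (u := mid \o p).
  move=> n k nk.
  have hk : @harmonic R k <= harmonic n by rewrite /= lef_pV2 ?posrE// ler_nat.
  have := seg 2^-1 (p n) (p k) _ (Kp n) (Kp k).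
  move/(_ ltac:(lra)); move: hk (gp n) (gp k); rewrite -(ip_normE ip_norm) /comp.
  lra.
exists c => a b Gab.
pose j := (a, b, ip a b); have Kj : K j by exact: GraphHullPoint.
(* Here [ip (c - a) (c - b) = g j + |c - mid j|^2], and [seg] from [p n] to [j] yields in the limit
   [(1 - t) |c - mid j|^2 <= s - g j]. *)
suff : ip (c - a) (c - b) - s <= 0 by lra.
apply: (@ler_small _ _ (ip (c - mid j) (c - mid j))) => t /andP[t0 t1].
have lim_n : (fun n => t * (1 - t) * `|mid (p n) - mid j| ^+ 2 - @harmonic R n)
    @ \oo --> t * (1 - t) * `|c - mid j| ^+ 2 - 0.
  apply: cvgB cvg_harmonic; apply: cvgMl_tmp; apply: cvg_sqr_norm.
  by apply: cvgB => //; exact: cvg_cst.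
have : t * (1 - t) * `|c - mid j| ^+ 2 - 0 <= t * (s - g j).
  apply: cvgr_to_le lim_n _; apply: nearW => n.
  have := seg t (p n) j ltac:(lra) (Kp n) Kj; have := gp n.
  have := mulr_ge0 (ltW t0) (@harmonic_ge0 R n).
  have : (1 - t) * (s - harmonic n) <= (1 - t) * g (p n).
    by apply: ler_wpM2l; [lra|exact/ltW/gp].
  rewrite (ip_normE ip_norm); lra.
rewrite subr0 -mulrA ler_pM2l// -(ip_normE ip_norm).
have -> : ip (c - a) (c - b) = g j + ip (c - mid j) (c - mid j).
  rewrite /g /mid/= !ipE (ipC _ b a) (ipC _ a c) (ipC _ b c); lra.
lra.
Qed.

(** Otherwise adjoining [(x, u)] to the graph would give a proper monotone extension. *)
Lemma max_monotone_graph M x u :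
  maximally_monotone_op ip M ->
  (forall y v, M y v -> 0 <= ip (x - y) (u - v)) -> M x u.
Proof.
move=> [monoM maxM] xuM; apply: contrapT => Mxu.
pose N y := [set v | M y v \/ (y = x /\ v = u)].
apply: (maxM N); last first.
  split=> [[y v] /= Myv|sub]; first by left.
  by apply: Mxu; apply: (sub (x, u)); right.
move=> y z v w [Myv|[-> ->]] [Mzw|[-> ->]].
- exact: monoM.
- by rewrite -(opprB x) -(opprB u) ipNl ipNr opprK; exact: xuM.
- exact: xuM.
- by rewrite !subrr ip0r.
Qed.

Lemma max_monotone_scale M (c : R) : 0 < c ->
  maximally_monotone_op ip M -> maximally_monotone_op ip (op_scale c M).
Proof.
move=> c0 maxM; have [monoM _] := maxM; split.
  move=> x y _ _ [u Mu <-] [v Mv <-].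
  by rewrite -scalerBr ipZr mulr_ge0 ?(ltW c0)//; exact: monoM.
move=> N monoN [subN]; apply => -[x u] /= Nxu.
exists (c^-1 *: u); last by rewrite scalerA divff ?gt_eqF// scale1r.
apply: max_monotone_graph maxM _ => y v Myv.
have Nyv : N y (c *: v) by apply: (subN (y, c *: v)); exists v.
rewrite -(pmulr_rge0 _ c0) -ipZr scalerBr scalerA divff ?gt_eqF// scale1r.
exact: monoN.
Qed.

(** The substitution [b = z - v] turns [M] into an antitone relation; its saddle point [c] makes
    [(c, z - c)] monotonically related to the graph. *)
Lemma minty M z : maximally_monotone_op ip M -> exists x, M x (z - x).
Proof.
move=> maxM; have [monoM _] := maxM.
have [|c cM] := @antitone_saddle (fun a b => M a (z - b)).
  move=> a b a' b' Mab Mab'; have := monoM _ _ _ _ Mab Mab'.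
  rewrite -oppr_ge0 -ipNr; congr (0 <= ip _ _).
  by rewrite opprB addrC subrKA opprB addrC.
exists c; apply: max_monotone_graph maxM _ => y v Myv.
have := cM y (z - v); rewrite subKr => /(_ Myv).
rewrite -oppr_ge0 -ipNr; congr (0 <= ip _ _).
by rewrite opprB addrAC.
Qed.

Lemma resolventP M x : maximally_monotone_op ip M ->
  M (resolvent M x) (x - resolvent M x).
Proof.
move=> maxM; have [y My] := minty x maxM.
have : exists y, op_inv (op_add (op_fun id) M) x y.
  exists y => /=; exists y => //; exists (x - y) => //; exact: subrKC.
move/getPex; rewrite -/(resolvent M x) => -[_ -> [v Mv vE]].
by rewrite -[X in X - _]vE addrAC subrr add0r.
Qed.

End Minty.

(** * Cluster points for affine inequalities *)

Section Cluster.
Variables (R : realType) (H : completeNormedModType R) (ip : {dot H for idfun}).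
Hypothesis ip_norm : induces_norm ip.

(** Reduces vector identities to linear arithmetic over the reals. *)
Lemma ip_inj a b : (forall y, ip a y = ip b y) -> a = b.
Proof.
move=> ab; apply/subr0_eq/normr0_eq0/eqP; rewrite -sqrf_eq0.
by rewrite -(ip_normE ip_norm) ipBl ab subrr.
Qed.

Lemma halfspace_pythagoras x y z : halfspace ip x y z ->
  `|x - y| ^+ 2 + `|z - y| ^+ 2 <= `|x - z| ^+ 2.
Proof.
rewrite /halfspace/= -!(ip_normE ip_norm) !ipE (ipC _ y x) (ipC _ z x) (ipC _ z y).
lra.
Qed.

(* A substitute for weak sequential compactness: the nested closed convex sets
   cut out by the affine inequalities satisfied by the tails of [x] have a
   common point, the limit of the projections of [x0] onto them. *)
Lemma bounded_affine_cluster (x : nat -> H) x0 (l : R) :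
  (forall n, `|x0 - x n| <= l) ->
  exists2 p, `|x0 - p| <= l &
    forall a c, (\forall n \near \oo, ip (x n) a <= c) -> ip p a <= c.
Proof.
move=> xl.
(* In effect, the closed convex hull of the tail from [n] on. *)
pose C n := \bigcap_(ac in [set ac : H * R |
    forall k, (n <= k)%N -> ip (x k) ac.1 <= ac.2]) [set p : H | ip p ac.1 <= ac.2].
have Cx n : C n (x n) by move=> ac /=; apply.
have clC n : closed (C n).
  by apply: closed_bigI => ac _; exact: closed_ip_le.
have cvxC n : convex_set (C n : set (convex_lmodType H)).
  by apply: convex_bigcap => ac _; exact: convex_ip_le.
have subC n k : (n <= k)%N -> C k `<=` C n.
  move=> nk p Cp ac xac; apply: Cp => i ki.
  by apply: xac; exact: leq_trans ki.
have ex n : exists p, C n p /\ forall q, C n q -> `|x0 - p| <= `|x0 - q|.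
  have [p ? ?] := nearest_exists ip_norm x0 (ex_intro _ _ (Cx n)) (clC n) (@cvxC n).
  by exists p.
have [p /all_and2[Cp px]] := choice ex.
have pl n : `|x0 - p n| <= l by apply: le_trans (px _ _ (Cx n)) (xl n).
(* Since [p k] lies in [C n], the angle at [p n] is obtuse; the distances to [x0] thus increase, and
   their convergence makes [p] Cauchy. *)
have step n k : (n <= k)%N ->
    `|x0 - p n| ^+ 2 + `|p n - p k| ^+ 2 <= `|x0 - p k| ^+ 2.
  move=> nk; rewrite (distrC (p n)); apply: halfspace_pythagoras.
  apply: (nearest_ip_le0 ip_norm (@cvxC n)) => //; first exact: px.
  exact: subC nk _ (Cp k).
have ndec : {homo (fun n => `|x0 - p n| ^+ 2) : n k / (n <= k)%N >-> n <= k}.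
  by move=> n k nk; apply: le_trans (step _ _ nk); rewrite lerDl exprn_ge0.
have cvg_a : cvgn (fun n => `|x0 - p n| ^+ 2).
  apply: nondecreasing_is_cvgn ndec _; exists (l ^+ 2) => _ [n _ <-].
  by rewrite ler_sqr ?nnegrE//; exact: le_trans (pl n).
set L := limn (fun n => `|x0 - p n| ^+ 2) in cvg_a.
have e0 : (fun n => L - `|x0 - p n| ^+ 2) @ \oo --> 0.
  by rewrite -[X in _ --> X](subrr L); apply: cvgB => //; exact: cvg_cst.
have [|y py] := cvg_sqr_dist e0 (u := p).
  move=> n k nk; have := step _ _ nk.
  by have := nondecreasing_cvgn_le ndec cvg_a k; rewrite -/L; lra.
exists y.
  have : (fun n => `|x0 - p n|) @ \oo --> `|x0 - y|.
    by apply: cvg_norm; apply: cvgB => //; exact: cvg_cst.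
  by move/cvgr_to_le; apply; apply: nearW.
move=> a c [N _ Nac].
have : C N y.
  by apply: closed_cvg py => //; exists N => // n /= Nn; exact: subC Nn _ (Cp n).
by move=> /(_ (a, c)); apply => k Nk; exact: Nac.
Qed.

End Cluster.

(** * Zeros of A + B and Tseng's step *)

Section ForwardBackwardForward.
Variables (R : realType) (H : completeNormedModType R) (ip : {dot H for idfun}).
Hypothesis ip_norm : induces_norm ip.
Variables (beta : R) (A : H -> set H) (B : H -> H).
Hypotheses (beta_gt0 : 0 < beta) (A_max : maximally_monotone_op ip A).
Hypotheses (B_mono : monotone_op ip (op_fun B)) (B_lip : beta.-lipschitz B).

Lemma op_add_funP x w : op_add A (op_fun B) x w <-> A x (w - B x).
Proof.
split=> [[u Au [_ -> <-]]|Aw]; first by rewrite addrK.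
by exists (w - B x) => //; exists (B x) => //; rewrite subrK.
Qed.

Lemma op_add_fun_monotone : monotone_op ip (op_add A (op_fun B)).
Proof.
move=> x y u v /op_add_funP Au /op_add_funP Av.
have := addr_ge0 (A_max.1 _ _ _ _ Au Av) (B_mono (erefl (B x)) (erefl (B y))).
rewrite -ipDr; congr (0 <= ip _ _).
by apply: (ip_inj ip_norm) => z; rewrite !ipE; lra.
Qed.

Lemma lip_norm x y : `|B x - B y| <= beta * `|x - y|.
Proof. exact: (@B_lip (x, y) (conj I I)). Qed.

(* Only the points [m = J_(g A) (p - g B p)] with [g beta < 1] are tested: for
   them monotonicity forces [m = p]. *)
Lemma zer_op_add_fun p :
  (forall u v, op_add A (op_fun B) u v -> ip p v <= ip u v) ->
  zer (op_add A (op_fun B)) p.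
Proof.
move=> pA.
(* With [g * beta = 1 / 2], the hypothesis at [m] gives [|p - m|^2 <= g * ip (p - m) (B p - B m) <=
   |p - m|^2 / 2]. *)
pose g := (2 * beta)^-1; have g0 : 0 < g by rewrite invr_gt0 mulr_gt0.
have := resolventP ip_norm (p - g *: B p) (max_monotone_scale g0 A_max).
set m := resolvent _ _ => -[u Amu gu].
have := pA m (u + B m).
rewrite op_add_funP addrK => /(_ Amu).
rewrite -subr_ge0 -ipBl -(pmulr_rge0 _ g0) -ipZr.
have -> : g *: (u + B m) = p - m - g *: (B p - B m).
  by rewrite scalerDr gu; apply: (ip_inj ip_norm) => y; rewrite !ipE; lra.
rewrite -(opprB p m) ipNl ipBr ipZr (ip_normE ip_norm).
have := ip_le_norm ip_norm (p - m) (B p - B m) => /(ler_wpM2l (ltW g0)).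
have := lip_norm p m => /(ler_wpM2l (mulr_ge0 (ltW g0) (normr_ge0 (p - m)))).
have -> : g * `|p - m| * (beta * `|p - m|) = 2^-1 * `|p - m| ^+ 2.
  by rewrite /g; field; rewrite gt_eqF.
move=> h1 h2 h3.
have /eqP : `|p - m| ^+ 2 = 0 by apply/le_anti; rewrite exprn_ge0// andbT; lra.
rewrite sqrf_eq0 normr_eq0 subr_eq0 => /eqP pm.
move: gu Amu; rewrite -pm addrAC subrr sub0r -scalerN.
move/(scalerI (lt0r_neq0 g0)) => ->.
by move=> ABp; apply/op_add_funP; rewrite sub0r.
Qed.

(** With [d = x - m] and [e = gamma (B x - B m)], [ip (m - r) (x - r) = (|e|^2 - |d|^2) / 4 <= 0],
    while [ip (z - m) (x - r) <= 0] by monotonicity. The bounds use [|e| <= (1 - eps) |d|] and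
    [gamma w = d - e = 2 (x - r)]. *)
Lemma fbf_step eps gamma x m r u :
  0 < eps -> eps <= gamma -> gamma * beta <= 1 - eps ->
  A m u -> gamma *: u = x - gamma *: B x - m ->
  r = (1 / 2) *: (x + m - gamma *: B m + gamma *: B x) ->
  (forall z, zer (op_add A (op_fun B)) z -> halfspace ip x r z) /\
  exists w, [/\ op_add A (op_fun B) m w, `|x - m| <= 2 / eps * `|x - r|
    & `|w| <= 2 / eps * `|x - r|].
Proof.
move=> eps0 eps_gamma gamma_beta Amu uE rE.
have gamma0 : 0 < gamma by exact: lt_le_trans eps_gamma.
set d := x - m; pose e := gamma *: (B x - B m).
have Bm : op_add A (op_fun B) m (u + B m) by rewrite op_add_funP addrK.
have wE : gamma *: (u + B m) = d - e.
  by rewrite scalerDr uE; apply: (ip_inj ip_norm) => y; rewrite !ipE; lra.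
have xrE : x - r = 2^-1 *: (d - e).
  by rewrite rE; apply: (ip_inj ip_norm) => y; rewrite !ipE; lra.
have mrE : m - r = - (2^-1 *: (d + e)).
  by rewrite rE; apply: (ip_inj ip_norm) => y; rewrite !ipE; lra.
have ed : `|e| <= (1 - eps) * `|d|.
  rewrite normrZ (gtr0_norm gamma0).
  apply: le_trans (ler_wpM2l (ltW gamma0) (lip_norm _ _)) _.
  by rewrite mulrA ler_wpM2r.
have nde : `|d - e| = 2 * `|x - r|.
  by rewrite xrE normrZ ger0_norm ?invr_ge0// mulrA divff ?mul1r.
split=> [z Zz|].
  have := op_add_fun_monotone Bm Zz.
  rewrite subr0 -(pmulr_rge0 _ gamma0) -ipZr wE => mz.
  have : `|e| ^+ 2 <= `|d| ^+ 2.
    rewrite ler_sqr ?nnegrE//; apply: le_trans ed _.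
    by rewrite ler_piMl//; lra.
  rewrite -!(ip_normE ip_norm) => ee.
  rewrite /halfspace/= -(subrKA m z) -(opprB m z) mrE xrE.
  move: mz ee; move: (d) (e) (m - z) => d' e' y.
  rewrite !ipE (ipC _ e' d'); lra.
exists (u + B m); split=> //; rewrite mulrAC ler_pdivlMr// -nde.
  by have := lerB_dist d e; lra.
by rewrite -wE normrZ (gtr0_norm gamma0) mulrC ler_wpM2r.
Qed.

End ForwardBackwardForward.

(** * Strong convergence of the iterates *)

Theorem theorem7p2 (R : realType) (H : completeNormedModType R)
  (ip : {dot H for idfun}) (ip_norm : induces_norm ip)
  (beta : R) (beta_gt0 : 0 < beta)
  (A : H -> set H) (A_max : maximally_monotone_op ip A)
  (B : H -> H) (B_mono : monotone_op ip (op_fun B)) (B_lip : beta.-lipschitz B)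
  (Z_neq0 : zer (op_add A (op_fun B)) !=set0)
  (x0 : H) (eps : R) (eps_gt0 : 0 < eps) (eps_lt : eps < 1 / (beta + 1))
  (gamma : nat -> R)
  (gamma_itv : forall n, eps <= gamma n <= (1 - eps) / beta)
  (b m r x : nat -> H)
  (x_init : x 0%N = x0)
  (bE : forall n, b n = gamma n *: B (x n))
  (mE : forall n, m n = resolvent (op_scale (gamma n) A) (x n - b n))
  (rE : forall n,
     r n = (1 / 2) *: (x n + m n - gamma n *: B (m n) + b n))
  (xE : forall n, x n.+1 = Qproj ip x0 (x n) (r n)) :
  (* the intersections onto which [Qproj] projects are nonempty, so that the
     sequence is well defined *)
  (forall n, halfspace ip x0 (x n) `&` halfspace ip (x n) (r n) !=set0) /\
  x @ \oo --> metric_proj (zer (op_add A (op_fun B))) x0.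
Proof.
set Z := zer _ in Z_neq0 *.
have step n : (forall z, Z z -> halfspace ip (x n) (r n) z) /\
  exists w, [/\ op_add A (op_fun B) (m n) w,
    `|x n - m n| <= 2 / eps * `|x n - r n| & `|w| <= 2 / eps * `|x n - r n|].
  have /andP[eps_gamma] := gamma_itv n; rewrite ler_pdivlMr// => gamma_beta.
  have gamma0 : 0 < gamma n by exact: lt_le_trans eps_gamma.
  have := resolventP ip_norm (x n - b n) (max_monotone_scale gamma0 A_max).
  rewrite -mE => -[u Amu uE].
  apply: (fbf_step ip_norm A_max B_mono B_lip eps_gt0 eps_gamma gamma_beta Amu).
    by rewrite uE bE.
  by rewrite rE bE.
have Zr n : Z `<=` halfspace ip (x n) (r n) := (step n).1.
have Zx n : Z `<=` halfspace ip x0 (x n).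
  elim: n => [z _|n IHn z Zz]; first by rewrite /halfspace/= x_init subrr ip0r.
  have Qz : (halfspace ip x0 (x n) `&` halfspace ip (x n) (r n)) z.
    by split; [exact: IHn|exact: Zr].
  by rewrite xE; apply: (QprojP ip_norm (ex_intro _ _ Qz)).2.
have Q0 n : halfspace ip x0 (x n) `&` halfspace ip (x n) (r n) !=set0.
  by have [z Zz] := Z_neq0; exists z; split; [exact: Zx|exact: Zr].
split=> //.
(* Pythagoras, as [x n.+1] lies in both half-spaces. *)
have xS n : `|x0 - x n| ^+ 2 + `|x n.+1 - x n| ^+ 2 <= `|x0 - x n.+1| ^+ 2 /\
    `|x n - r n| ^+ 2 <= `|x n.+1 - x n| ^+ 2.
  have [] := (QprojP ip_norm (Q0 n)).1; rewrite -xE.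
  move=> /(halfspace_pythagoras ip_norm) h /(halfspace_pythagoras ip_norm).
  rewrite (distrC _ (x n.+1)); split=> //.
  by have := sqr_ge0 `|x n.+1 - r n|; lra.
pose a n : R := `|x0 - x n| ^+ 2.
have aZ n z : Z z -> a n + `|z - x n| ^+ 2 <= `|x0 - z| ^+ 2.
  by move=> Zz; apply: (halfspace_pythagoras ip_norm); exact: Zx.
have ndec : {homo a : n k / (n <= k)%N >-> n <= k}.
  apply/nondecreasing_seqP => n; have := (xS n).1.
  by have := sqr_ge0 `|x n.+1 - x n|; rewrite /a; lra.
have cvg_a : cvgn a.
  have [z Zz] := Z_neq0; apply: nondecreasing_is_cvgn ndec _.
  exists (`|x0 - z| ^+ 2) => _ [n _ <-].
  by have := aZ n z Zz; have := sqr_ge0 `|z - x n|; lra.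
set L := limn a in cvg_a.
have aL n : a n <= L by exact: nondecreasing_cvgn_le.
have LZ z : Z z -> L <= `|x0 - z| ^+ 2.
  move=> Zz; apply: limr_le => //; apply: nearW => n.
  by have := aZ n z Zz; have := sqr_ge0 `|z - x n|; lra.
have L0 : 0 <= L by apply: le_trans (aL 0%N); exact: sqr_ge0.
have xl n : `|x0 - x n| <= Num.sqrt L.
  by rewrite -[leLHS]normr_id -sqrtr_sqr; apply: ler_wsqrtr; exact: aL.
have rho0 : (fun n => 2 / eps * `|x n - r n|) @ \oo --> 0.
  rewrite -[X in _ --> X](mulr0 (2 / eps)); apply: cvgMl_tmp.
  have da0 : (fun n => a n.+1 - a n) @ \oo --> 0.
    rewrite -[X in _ --> X](subrr L); apply: cvgB => //.
    by rewrite (cvg_shiftS a).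
  apply/cvgrPdist_le => e e0; have nearda := cvgr_le 0 da0 _ (exprn_gt0 2 e0).
  near=> n; have dan : a n.+1 - a n <= e ^+ 2 by near: n; exact: nearda.
  rewrite sub0r normrN normr_id.
  rewrite -ler_sqr ?nnegrE ?(ltW e0)//; move: dan.
  by have [] := xS n; rewrite /a; lra.
have [p px0 pa] := bounded_affine_cluster ip_norm xl.
have Zp : Z p.
  apply: (zer_op_add_fun ip_norm (beta := beta)) => // u v Buv.
  (* With slack [e], the inequality is affine in [p] and need only hold eventually along [x]. *)
  apply/ler_addgt0Pr => e e0; apply: pa.
  (* The errors from replacing [x n] by [m n] and from [w] sum to at most [k * s]: [|m n - u|]
     contributes the first three terms, [v] the rest. *)
  pose k := Num.sqrt L + `|x0 - u| + 1 + `|v| + 1.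
  have k0 : 0 < k by rewrite ltr_wpDl// !addr_ge0// sqrtr_ge0.
  have near1 := cvgr_le 0 rho0 _ ltr01.
  have near2 := cvgr_le 0 rho0 _ (divr_gt0 e0 k0).
  near=> n.
  have [_ [w [Bmw dn wn]]] := step n.
  have s1 : 2 / eps * `|x n - r n| <= 1 by near: n; exact: near1.
  have : 2 / eps * `|x n - r n| <= e / k by near: n; exact: near2.
  rewrite ler_pdivlMr//; move: dn wn s1; set s := 2 / eps * _ => dn wn s1 se.
  have := op_add_fun_monotone ip_norm A_max B_mono Bmw Buv.
  rewrite ipBr subr_ge0 => mv.
  have mu : `|m n - u| <= Num.sqrt L + `|x0 - u| + 1.
    have := ler_distD (x n) (m n) u; have := ler_distD x0 (x n) u.
    by rewrite (distrC (x n) x0) (distrC (m n) (x n)); have := xl n; lra.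
  have h1 : ip (m n - u) w <= (Num.sqrt L + `|x0 - u| + 1) * s.
    by apply: le_trans (ip_le_norm ip_norm _ _) _; exact: ler_pM.
  have h2 : ip (x n - m n) v <= s * (`|v| + 1).
    apply: le_trans (ip_le_norm ip_norm _ _) _; apply: ler_pM => //.
    by rewrite lerDl.
  have se' : (Num.sqrt L + `|x0 - u| + 1) * s + s * (`|v| + 1) <= e.
    by rewrite [_ * s]mulrC -mulrDr !addrA.
  move: mv h1 h2 se'; rewrite !ipBl; lra.
have pL z : Z z -> `|x0 - p| <= `|x0 - z|.
  move=> Zz; apply: le_trans px0 _.
  by rewrite -[leRHS]normr_id -sqrtr_sqr ler_wsqrtr// LZ.
have [] := metric_projP Zp pL; set q := metric_proj Z x0 => Zq qL.
(* Combined with [aZ], this bounds [|q - x n|^2] by [L - a n]. *)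
have x0q : `|x0 - q| ^+ 2 <= L.
  rewrite -(sqr_sqrtr L0) ler_sqr ?nnegrE ?sqrtr_ge0//.
  exact: le_trans (qL _ Zp) px0.
have La0 : (fun n => L - a n) @ \oo --> 0.
  by rewrite -[X in _ --> X](subrr L); apply: cvgB => //; exact: cvg_cst.
apply/cvgrPdist_le => e e0; have nearL := cvgr_le 0 La0 _ (exprn_gt0 2 e0).
near=> n; have Lan : L - a n <= e ^+ 2 by near: n; exact: nearL.
by rewrite -ler_sqr ?nnegrE ?(ltW e0)//; have := aZ n q Zq; lra.
Unshelve. all: by end_near. Qed.
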